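(* Let $k$ and $r$ be positive integers with $r<k$, and let $\mathbf p=(p_1,\ldots,p_k)$ be a tuple of non-negative integers such that $\mathcal M_{\mathbf p,r}\neq\emptyset$. Let $\mathbf S=(S_1,\ldots,S_r)$ be a uniformly random element of $\mathcal M_{\mathbf p,r}$, and let $\varphi$ be a uniformly random surjection from $[k-1]$ to $[r]$, independent of $\mathbf S$. For $\zeta\in\{\alpha,\beta,\gamma\}$ let $P_\zeta(\mathbf p,r)$ be the probability that the random digraph $G_\zeta(\mathbf S,\varphi)$ is a tree. Then: (a) $P_\alpha(\mathbf p,r)=1-p_k/r$; this equals the probability that $k\notin S_1$. (b) $P_\beta(\mathbf p,r)=|\mathcal M_{\mathbf q,r-1}|/|\mathcal M_{\mathbf p,r}|$ where $\mathbf q=(p_1,p_2-1,p_3-1,\ldots,p_k-1)$; this equals the probability that $S_1=\{2,3,\ldots,k\}$. (c) $P_\gamma(\mathbf p,r)=\sum_{j=1}^k|\mathcal M_{\mathbf q^{(j)},r-1}|/|\mathcal M_{\mathbf p,r}|$, where $\mathbf q^{(j)}=(q^{(j)}_1,\ldots,q^{(j)}_k)$ with $q^{(j)}_i=p_i-1$ for $i\neq j$ and $q^{(j)}_j=p_j$; this equals the probability that $|S_1|=k-1$.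
   Context: $[k]=\{1,\ldots,k\}$. For $i,j\in[k]$, $]i,j]$ denotes $\{i+1,i+2,\ldots,j\}$ with integers considered cyclically modulo $k$ (so $]i,i]=\emptyset$, $]i,i+1]=\{i+1\}$, $]i,i-1]=[k]\setminus\{i\}$). For a non-negative integer $r$ and a tuple $\mathbf p=(p_1,\ldots,p_k)$ of non-negative integers, $\mathcal S_{\mathbf p,r}$ is the set of tuples $(S_1,\ldots,S_r)$ of subsets of $[k]$ such that each $j\in[k]$ is contained in exactly $p_j$ of the sets $S_1,\ldots,S_r$, and $\mathcal M_{\mathbf p,r}$ is the set of those tuples in $\mathcal S_{\mathbf p,r}$ with $S_i\neq[k]$ for all $i$. For $i\in[k]$ and $S\subseteq[k]$ define (all integers cyclically modulo $k$): $\alpha(i,S)=i$ if $S=[k]$, and otherwise $\alpha(i,S)$ is the $j\in[k]$ with $j\notin S$ and $]i,j-1]\subseteq S$; $\beta(i,S)=i$ if $S=[k]$, and otherwise $\beta(i,S)$ is the $j\in[k]$ with $j+1\notin S$ and $]i,j]\subseteq S$; $\gamma(i,S)=i$ if $S=[k]$, $\gamma(i,S)=i-1$ if $i\in S\neq[k]$, and otherwise $\gamma(i,S)$ is the $j\in[k]$ with $j+1\notin S$ and $]i,j]\subseteq S$. For $\mathbf S=(S_1,\ldots,S_r)\in\mathcal S_{\mathbf p,r}$, a surjection $\varphi:[k-1]\to[r]$ and $\zeta\in\{\alpha,\beta,\gamma\}$, $G_\zeta(\mathbf S,\varphi)$ is the digraph with vertex set $[k]$ and arcs $a_i=(i,\zeta(i,S_{\varphi(i)}))$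 for $i\in[k-1]$. ''Tree'' means the underlying graph with these $k-1$ arcs is a spanning tree (necessarily oriented toward vertex $k$). *)

(* Defs.v *)
From HB Require Import structures.
From mathcomp Require Import all_boot all_order all_algebra.

Set Implicit Arguments.
Unset Strict Implicit.
Unset Printing Implicit Defensive.

Import Order.TTheory GRing.Theory Num.Theory.
Local Open Scope ring_scope.

(* Throughout, k = n.+1 and the integer i in [k] is the ordinal of value i - 1
   in 'I_n.+1: vertex 1 is ord0 and vertex k is ord_max.  The integers in
   [k-1] are the elements of 'I_n, seen in [k] through widen_ord.  Modulo k,
   i + 1 and i - 1 are ordS i and ord_pred i, and the difference of two
   elements is taken in the cyclic group 'I_n.+1. *)

Section CyclicIntervals.
Variable n : nat.
Implicit Types (i j x : 'I_n.+1) (S : {set 'I_n.+1}).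

(* The elements i + 1, ..., i + d, where d in {0, ..., k-1} is j - i mod k. *)
Definition cyc_itv i j : {set 'I_n.+1} :=
  [set x | (0 < (x - i)%R <= (j - i)%R)%N].

(* When S is not the full set, exactly one j satisfies each of the conditions
   below, so that the default value of odflt is never used. *)
Definition alpha i S : 'I_n.+1 :=
  if S == setT then i
  else odflt i [pick j | (j \notin S) && (cyc_itv i (ord_pred j) \subset S)].

Definition beta i S : 'I_n.+1 :=
  if S == setT then i
  else odflt i [pick j | (ordS j \notin S) && (cyc_itv i j \subset S)].

Definition gamma i S : 'I_n.+1 :=
  if S == setT then i
  else if i \in S then ord_pred i
  else odflt i [pick j | (ordS j \notin S) && (cyc_itv i j \subset S)].

End CyclicIntervals.

Section SetTuples.
Variable n : nat.
Implicit Types p : 'I_n.+1 -> int.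

(* The multiplicities are integers, not natural numbers, so that p j - 1 is a
   genuine subtraction: there is no tuple of sets when some p j is negative. *)
Definition calS p (r : nat) : {set {ffun 'I_r -> {set 'I_n.+1}}} :=
  [set S : {ffun 'I_r -> {set 'I_n.+1}} |
    [forall j, #|[set i | j \in S i]|%:Z == p j]].

Definition calM p (r : nat) : {set {ffun 'I_r -> {set 'I_n.+1}}} :=
  [set S in calS p r | [forall i, S i != setT]].

Definition dec_except p (j i : 'I_n.+1) : int := if i == j then p i else p i - 1.

End SetTuples.

Definition surjections (aT rT : finType) : {set {ffun aT -> rT}} :=
  [set f : {ffun aT -> rT} | [forall y, exists x, f x == y]].

Section Trees.
(* A digraph with vertex set V and arcs indexed by E; arc e goes from
   (arc e).1 to (arc e).2.  Loops and parallel arcs are allowed. *)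
Variables (V E : finType) (arc : E -> V * V).

Definition joins (e : E) (x y : V) : bool :=
  (arc e == (x, y)) || (arc e == (y, x)).

Definition connected_graph : bool :=
  [forall x, forall y, connect [rel u v | [exists e, joins e u v]] x y].

(* A cycle x_1, e_1, x_2, e_2, ..., x_m, e_m, x_1 with m >= 1, distinct x_i
   and distinct e_i, is the list of the pairs (x_i, e_i).  A loop is a cycle
   with m = 1, and two parallel or opposite arcs form a cycle with m = 2. *)
Definition is_cycle (c : seq (V * E)) : bool :=
  [&& c != [::], uniq (unzip1 c), uniq (unzip2 c)
    & cycle [rel u v | joins u.2 u.1 v.1] c].

(* The x_i being distinct, a cycle has length at most #|V|. *)
Definition acyclic_graph : bool :=
  [forall m : 'I_#|V|.+1, forall c : m.-tuple (V * E), ~~ is_cycle c].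

Definition is_tree : bool := connected_graph && acyclic_graph.

End Trees.

Definition Gdigraph (n r : nat) (zeta : 'I_n.+1 -> {set 'I_n.+1} -> 'I_n.+1)
    (S : {ffun 'I_r -> {set 'I_n.+1}}) (phi : {ffun 'I_n -> 'I_r})
    (i : 'I_n) : 'I_n.+1 * 'I_n.+1 :=
  let v := widen_ord (leqnSn n) i in (v, zeta v (S (phi i))).

Section FiniteProbability.

Definition unif (T : finType) (A : {set T}) (x : T) : rat :=
  (x \in A)%:R / #|A|%:R.

(* The joint law of two independent variables with laws mu and nu. *)
Definition indep (T U : finType) (mu : T -> rat) (nu : U -> rat) (x : T * U) :
  rat := mu x.1 * nu x.2.

Definition Pr (T : finType) (mu : T -> rat) (A : pred T) : rat :=
  \sum_(x | A x) mu x.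

End FiniteProbability.

Definition Ptree (n : nat) (zeta : 'I_n.+1 -> {set 'I_n.+1} -> 'I_n.+1)
    (p : 'I_n.+1 -> int) (r : nat) : rat :=
  Pr (indep (unif (calM p r)) (unif (surjections 'I_n 'I_r)))
     (fun x => is_tree (Gdigraph zeta x.1 x.2)).

(* Main.v *)
Require Import Defs.
From HB Require Import structures.
From mathcomp Require Import all_boot all_order all_algebra.
From mathcomp Require Import perm mpoly zify ring.

Set Implicit Arguments.
Unset Strict Implicit.
Unset Printing Implicit Defensive.

Import Order.TTheory GRing.Theory Num.Theory.
Local Open Scope ring_scope.

(** For r = 1 the digraph is a tree exactly when k is not in S (alpha), when
    S = {2, ..., k} (beta), when |S| = k - 1 (gamma).  The point is that the
    number of S in M_p for which G(S, phi) is a tree does not depend on phi,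
    which need not even be surjective: a constant phi then reduces everything
    to r = 1.

    Follow the walk from a vertex as a token (j, c), "about to test position j
    with colour c": it moves to (j + 1, c) if j is in S_c and stops at a vertex
    otherwise.  The linear relations between tokens and vertices form a square
    matrix in which every condition "j in S_c" occurs in a single row.  Its
    determinant is 0 if some S_c is full, and otherwise, by eliminating the
    tokens, it is the reduced Laplacian determinant of G(S, phi), which
    indicates that G(S, phi) is a tree.  By multilinearity, the sum over all S
    of t^p(S) times this determinant is the determinant of the matrix with each
    token row replaced by the combination of its two values with weights t_j
    and 1; now the relations treat all colours alike, so that eliminating the
    tokens leaves a matrix in which phi has disappeared.  The coefficient of
    t^p is the number of trees.

    For gamma, the arc relation of i modulo the token relations is the
    difference of the beta relations of i and i - 1, which does not mention
    S at all. *)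

(** * Determinants *)

Section FunctionalGraphDeterminant.
Variables (R : idomainType) (m : nat) (T : eqType) (w h : 'I_m -> T).

(** For injective [w], the reduced Laplacian of the graph with arcs from [w i] to [h i]; points
    outside the image of [w] act as roots and have no column. *)
Definition arc_mx : 'M[R]_m := \matrix_(i, j) ((i == j)%:R - (h i == w j)%:R).

(* A permutation contributing to the determinant only uses fixed points and
   arcs; the sum of the ranks being invariant, it uses no arc. *)
Lemma det_arc_mx1 (d : T -> nat) :
  (forall i, (d (h i) < d (w i))%N) -> \det arc_mx = 1.
Proof.
move=> dlt; rewrite /determinant (bigD1 (1%g : 'S_m)) //= odd_perm1 mul1r.
rewrite [X in X + _]big1 => [|i _]; last first.
  rewrite mxE perm1 eqxx; case: eqP => [e|_]; last by rewrite subr0.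
  by have := dlt i; rewrite e ltnn.
rewrite big1 ?addr0 // => s s_neq1.
suff [i /eqP hi0] : exists i, arc_mx i (s i) == 0.
  by rewrite (bigD1 i) //= hi0 mul0r mulr0.
apply/existsP/contraT; rewrite negb_exists => /forallP nz.
have dle i : (d (w (s i)) <= d (w i) ?= iff (s i == i))%N.
  have := nz i; rewrite mxE (eq_sym i); case: (s i =P i) => [-> _|ne].
    exact/leqif_refl.
  case: (h i =P _) => [e _|_]; last by rewrite subrr eqxx.
  by have lt := dlt i; rewrite e in lt; split; [exact: ltnW|rewrite ltn_eqF].
have [_] := leqif_sum (fun i (_ : true) => dle i).
rewrite [X in _ == X](reindex_inj (@perm_inj _ s)) /= eqxx => /esym/forallP all1.
by case/eqP: s_neq1; apply/permP => i; rewrite perm1; apply/eqP/all1.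
Qed.

(** The indicator of [C] is a nonzero column vector in the kernel: as no root lies in [C], row i
    evaluates to C (w i) - C (h i). *)
Lemma det_arc_mx0 (C : pred T) (i0 : 'I_m) : injective w ->
  (forall i, C (h i) = C (w i)) -> (forall x, C x -> exists j, x = w j) ->
  C (w i0) -> \det arc_mx = 0.
Proof.
move=> w_inj Ch Cw Ci0; apply/eqP; rewrite -det_tr; apply/det0P.
exists (\row_j (C (w j))%:R).
  by apply/eqP => /rowP/(_ i0)/eqP; rewrite !mxE Ci0 oner_eq0.
apply/rowP => i; rewrite !mxE.
under eq_bigr => j _ do rewrite !mxE mulrBr.
rewrite sumrB (bigD1 i) //= eqxx mulr1 big1 ?addr0; last first.
  by move=> j /negPf ne; rewrite eq_sym ne mulr0.
rewrite -Ch; case: (boolP (C (h i))) => [/[dup] Chi /Cw[j hij]|nC].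
  rewrite (bigD1 j) //= -{1}hij Chi -hij eqxx mulr1 big1 ?addr0 ?subrr //.
  move=> j' ne; rewrite hij (inj_eq w_inj) eq_sym (negPf ne) mulr0 //.
rewrite big1 ?subr0 // => j _; case: eqP => [e|_]; last by rewrite mulr0.
by rewrite -e (negPf nC) mul0r.
Qed.

End FunctionalGraphDeterminant.

(** Multilinearity in the upper rows: [f] picks one summand in each of them. *)
Lemma det_sum_rows (R : comNzRingType) (N m : nat) (B : finType)
    (c : B -> 'I_N -> R) (G : B -> 'M[R]_(N, N + m)) (V : 'M[R]_(m, N + m)) :
  \det (col_mx (\matrix_(i, j) \sum_b c b i * G b i j) V)
  = \sum_(f : {ffun 'I_N -> B}) (\prod_i c (f i) i)
      * \det (col_mx (\matrix_(i, j) G (f i) i j) V).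
Proof.
rewrite /determinant; under [RHS]eq_bigr => f _ do rewrite mulr_sumr.
rewrite exchange_big /=; apply: eq_bigr => s _.
rewrite big_split_ord /=.
under eq_bigr => i _ do rewrite col_mxEu mxE.
rewrite bigA_distr_bigA mulr_suml mulr_sumr; apply: eq_bigr => f _ /=.
rewrite big_split big_split_ord /= mulrCA -!mulrA.
congr (_ * _); rewrite [in LHS]mulrCA; congr (_ * (_ * _)).
  by apply: eq_bigr => i _; rewrite col_mxEu mxE.
by apply: eq_bigr => i _; rewrite !col_mxEd.
Qed.

(** * Cyclic successors *)

Section CyclicSuccessors.
Variable n : nat.
Implicit Types (i j x y : 'I_n.+1) (S : {set 'I_n.+1}).

Lemma val_subI x y :
  (x - y)%R = (if (y <= x)%N then x - y else x + n.+1 - y)%N :> nat.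
Proof.
have [xn yn] := (ltn_ord x, ltn_ord y); rewrite /= modnDmr.
case: leqP => yx; last by rewrite modn_small; lia.
have -> : (x + (n.+1 - y) = (x - y) + n.+1)%N by lia.
by rewrite modnDr modn_small //; lia.
Qed.

Lemma val_ordS x : ordS x = (if x == ord_max then 0 else x.+1)%N :> nat.
Proof.
have := ltn_ord x; rewrite -val_eqE /=; case: eqP => [-> _|]; first by rewrite modnn.
by move=> ? ?; rewrite modn_small; lia.
Qed.

Lemma val_ord_pred x : ord_pred x = (if x == ord0 then n else x.-1)%N :> nat.
Proof.
have := ltn_ord x; rewrite -val_eqE /=; case: eqP => [-> _|].
  by rewrite modn_small.
move=> ? ?; have -> : ((x + n.+1).-1 = x.-1 + n.+1)%N by lia.
by rewrite modnDr modn_small //; lia.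
Qed.

Lemma val_subI_ordS x y : x != y -> (x - ordS y)%R = (x - y)%R.-1 :> nat.
Proof.
rewrite -val_eqE => /eqP ne; rewrite !val_subI val_ordS -val_eqE /=.
have [xn yn] := (ltn_ord x, ltn_ord y).
by case: (y =P n :> nat) => e; do 2?[case: leqP => ?]; move: ne => /=; lia.
Qed.

Lemma val_subI_gt0 x y : (0 < (x - y)%R)%N = (x != y).
Proof.
have [xn yn] := (ltn_ord x, ltn_ord y).
by rewrite val_subI -val_eqE /=; case: (leqP y x) => ?; lia.
Qed.

(** Distances are measured from i + 1, which makes i the farthest point; the interval up to j - 1 is
    then a strict inequality, even for j = i. *)
Lemma in_cyc_itv_pred i j x :
  (x \in cyc_itv i (ord_pred j)) = ((x - ordS i)%R < (j - ordS i)%R)%N.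
Proof.
have dist y : (y - ordS i)%R = (if y == i then n else (y - i)%R.-1) :> nat.
  case: eqVneq => [->|]; last exact: val_subI_ordS.
  rewrite val_subI val_ordS -val_eqE /=; have := ltn_ord i.
  by case: (i =P n :> nat) => ? ?; case: leqP => ?; lia.
have distp : (ord_pred j - i)%R = (j - ordS i)%R :> nat.
  have [jn iN] := (ltn_ord j, ltn_ord i).
  rewrite dist !val_subI val_ord_pred -!val_eqE /=.
  by case: (j =P 0%N :> nat) => ?; case: (j =P i :> nat) => ?;
    case: (leqP i j) => ?; case: leqP => ?; lia.
have [xn jn] := (ltn_ord (x - i)%R, ltn_ord (j - i)%R).
have x0 := val_subI_gt0 x i; rewrite inE distp !dist.
by case: (x =P i) x0 => ? /= x0; case: (j =P i) => ?; lia.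
Qed.

Lemma alphaP i S : S != setT ->
  (alpha i S \notin S) *
  (forall x, ((x - ordS i)%R < (alpha i S - ordS i)%R)%N -> x \in S).
Proof.
move=> SnT; rewrite /alpha (negPf SnT); case: pickP => /= [j /andP[jS jmin]|no].
  by split=> // x; rewrite -in_cyc_itv_pred => /(subsetP jmin).
have [j0 j0S] : exists j, j \notin S.
  apply/existsP; rewrite -negb_forall; apply: contra SnT => /forallP h.
  by apply/eqP/setP => x; rewrite h inE.
case: (@arg_minnP _ j0 (fun j => j \notin S) (fun j => (j - ordS i)%R : nat) j0S).
move=> j jS jmin; have /negP[] := no j; rewrite jS; apply/subsetP => x.
rewrite in_cyc_itv_pred; apply: contraTT => /jmin; rewrite -leqNgt //.
Qed.

Lemma alpha_eq i j S : j \notin S ->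
  (forall x, ((x - ordS i)%R < (j - ordS i)%R)%N -> x \in S) -> alpha i S = j.
Proof.
move=> jS jmin; have SnT : S != setT by apply: contraNneq jS => ->; rewrite inE.
have [aS amin] := alphaP i SnT; apply/(@addIr _ (- ordS i))/val_inj.
apply/eqP; rewrite eqn_leq.
apply/andP; split; rewrite leqNgt; apply/negP.
  by move/amin; rewrite (negPf jS).
by move/jmin; rewrite (negPf aS).
Qed.

(** One step of the walk. As [alpha (ord_pred j) S] is the first non-element met from j on, this is
    the token relation at j = i + 1. *)
Lemma alpha_rec i S : S != setT ->
  alpha i S = if ordS i \in S then alpha (ordS i) S else ordS i.
Proof.
move=> SnT; case: ifPn => iS; last first.
  by apply: alpha_eq => // x; rewrite subrr ltn0.
have [aS amin] := alphaP (ordS i) SnT; apply: alpha_eq => // x lt.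
have [-> //|xi] := eqVneq x (ordS i); apply: amin.
have ai : alpha (ordS i) S != ordS i by apply: contraNneq aS => ->.
move: lt; rewrite (val_subI_ordS xi) (val_subI_ordS ai).
by have := val_subI_gt0 x (ordS i); rewrite xi; lia.
Qed.

Lemma beta_alpha i S : S != setT -> beta i S = ord_pred (alpha i S).
Proof.
move=> SnT; have [aS amin] := alphaP i SnT; rewrite /beta (negPf SnT).
case: pickP => /= [j /andP[jS jmin]|/(_ (ord_pred (alpha i S)))].
  apply/eqP; rewrite -(inj_eq (can_inj (@ordSK n.+1))) ord_predK; apply/eqP/esym.
  apply: alpha_eq => // x; rewrite -in_cyc_itv_pred ordSK.
  exact: (subsetP jmin).
rewrite ord_predK aS => /negP[]; apply/subsetP => x.
by rewrite in_cyc_itv_pred; apply: amin.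
Qed.

Lemma gamma_beta i S : S != setT ->
  gamma i S = if i \in S then ord_pred i else beta i S.
Proof. by move=> SnT; rewrite /gamma /beta (negPf SnT). Qed.

End CyclicSuccessors.

(** * The token matrix *)

Lemma sum_enum_val (R : nmodType) (T : finType) (F : T -> R) :
  \sum_(q < #|{: T}|) F (enum_val q) = \sum_x F x.
Proof. by rewrite [RHS](reindex _ (onW_bij _ (enum_val_bij T))). Qed.

Lemma sum_delta (R : pzRingType) (T : finType) (F : T -> R) (x : T) :
  \sum_y (x == y)%:R * F y = F x.
Proof.
rewrite (bigD1 x) //= eqxx mul1r big1 ?addr0 // => y.
by rewrite eq_sym => /negPf ->; rewrite mul0r.
Qed.

Section TokenMatrix.
Variables (n r : nat) (stop : 'I_n.+1 -> 'I_n.+1).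

(* The token (j, c) has colour c and is about to test whether j is in S_c; if
   not, it stops at the vertex [stop j]. *)
Local Notation token := ('I_n.+1 * 'I_r)%type.
Local Notation N := #|{: token}|.

Definition next_token (x : token) : token := (ordS x.1, x.2).

Lemma next_token_inj : injective next_token.
Proof.
move=> [j c] [j' c'] /eqP/andP[/eqP/(can_inj (@ordSK n.+1)) /= ->].
by move=> /eqP /= ->.
Qed.

Section Ring.
Variable R : idomainType.

(** The arc relation of i sees only tokens of colour [phi i]; no other block of the token matrix
    depends on [phi]. *)
Definition vertex_token_mx (b : 'M[R]_(n, n.+1)) (phi : 'I_n -> 'I_r) :
    'M[R]_(n, N) :=
  \matrix_(i, q) (b i (enum_val q).1 * ((enum_val q).2 == phi i)%:R).

Lemma vertex_token_mxM (b : 'M[R]_(n, n.+1)) phi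
    (z : token -> 'I_n -> R) i v :
  (vertex_token_mx b phi *m \matrix_(q, u) z (enum_val q) u) i v
  = \sum_j b i j * z (j, phi i) v.
Proof.
rewrite mxE; under eq_bigr => q _ do rewrite !mxE.
rewrite (sum_enum_val (fun x : token => b i x.1 * (x.2 == phi i)%:R * z x v)).
pose F j c := b i j * (c == phi i)%:R * z (j, c) v.
rewrite (eq_bigr (fun x => F x.1 x.2)) => [|[j c] _] //; rewrite -(pair_bigA _ F).
apply: eq_bigr => j _ /=; rewrite -[RHS]mulr1 -mulrA.
rewrite -(sum_delta (fun c => z (j, c) v)) mulr1 mulr_sumr.
by apply: eq_bigr => c _; rewrite eq_sym mulrA.
Qed.

(* The relations x_(j,c) = y_j x_(j+1,c) + (1 - y_j) e_(stop j), where
   y_j = t_j / (1 + t_j), cleared of their denominators: since the weights do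
   not depend on the colour c, neither does their solution. *)
Lemma det_block_colour_blind (t : 'I_n.+1 -> R) (b : 'M[R]_(n, n.+1))
    (A : 'M[R]_n) (phi phi' : 'I_n -> 'I_r) :
  let C := \matrix_(j, j') ((1 + t j) * (j == j')%:R
                            - t j * (ordS j == j')%:R) in
  let P := \matrix_(q < N, q' < N) ((1 + t (enum_val q).1) * (q == q')%:R
             - t (enum_val q).1 * (next_token (enum_val q) == enum_val q')%:R) in
  let E := \matrix_(q < N, v < n)
             - (stop (enum_val q).1 == widen_ord (leqnSn n) v)%:R in
  \det C != 0 ->
  \det (block_mx P E (vertex_token_mx b phi) A : 'M_(N + n))
  = \det (block_mx P E (vertex_token_mx b phi') A).
Proof.
move=> C P E C_neq0.
have [z Cz] : exists z : 'I_n.+1 -> 'I_n -> R, forall j v,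
    (1 + t j) * z j v - t j * z (ordS j) v
    = \det C * (stop j == widen_ord (leqnSn n) v)%:R.
  pose e : 'M[R]_(n.+1, n) :=
    \matrix_(j < n.+1, v < n) (stop j == widen_ord (leqnSn n) v)%:R.
  exists (\adj C *m e) => j v.
  have /matrixP/(_ j v) : C *m (\adj C *m e) = \det C *: e.
    by rewrite mulmxA mul_mx_adj mul_scalar_mx.
  rewrite mxE [in RHS]mxE [in RHS]mxE => <-; move: (\adj C *m e) => z.
  under eq_bigr => i _ do rewrite mxE mulrBl -!mulrA.
  by rewrite sumrB -!mulr_sumr !(sum_delta (fun k => z k v)).
pose Z := \matrix_(q < N, v < n) (fun x : token => z x.1) (enum_val q) v.
have PZ : P *m Z + E *m (\det C)%:M = 0.
  apply/matrixP => q v; rewrite mul_mx_scalar !mxE.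
  under eq_bigr => q' _ do rewrite !mxE mulrBl -!mulrA -(inj_eq enum_val_inj).
  rewrite sumrB -!mulr_sumr.
  rewrite !(sum_enum_val (fun y : token => (_ == y)%:R * z y.1 v)).
  by rewrite !(sum_delta (fun y : token => z y.1 v)) Cz mulrN subrr.
(* Multiplying on the right by the block matrix with rows (1, Z) and (0, [\det C]) clears the upper
   right block; what remains does not involve [f]. *)
have detE f : \det (block_mx P E (vertex_token_mx b f) A) * \det C ^+ n
    = \det P * \det (\matrix_(i, v) (\sum_j b i j * z j v + \det C * A i v)).
  rewrite -det_scalar -[\det (\det C)%:M]mul1r -(det1 R N).
  rewrite -(det_ublock _ Z) -det_mulmx mulmx_block !mulmx1 !mulmx0 !addr0 PZ.
  rewrite det_lblock; congr (_ * \det _); apply/matrixP => i v.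
  by rewrite mxE vertex_token_mxM mul_mx_scalar !mxE.
by apply: (mulIf (expf_neq0 n C_neq0)); rewrite !detE.
Qed.

End Ring.

Section Evaluation.
Variable R : idomainType.

(** Vertex k has no column: it is the root, whose unknown is set to 0. *)
Definition token_row (goes : bool) : 'M[R]_(N, N + n) :=
  row_mx (\matrix_(q < N, q' < N)
            ((q == q')%:R - (goes && (next_token (enum_val q) == enum_val q'))%:R))
         (\matrix_(q < N, v < n)
            - (~~ goes && (stop (enum_val q).1 == widen_ord (leqnSn n) v))%:R).

Definition set_mx (S : 'I_r -> {set 'I_n.+1}) (b : 'M[R]_(n, n.+1))
    (A : 'M[R]_n) (phi : 'I_n -> 'I_r) : 'M[R]_(N + n) :=
  col_mx (\matrix_(q, u) token_row ((enum_val q).1 \in S (enum_val q).2) q u)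
         (row_mx (vertex_token_mx b phi) A).

Lemma set_mx_block S b A phi : set_mx S b A phi =
  let goes x := x.1 \in S x.2 in
  block_mx
   (\matrix_(q < N, q' < N) ((q == q')%:R
      - (goes (enum_val q) && (next_token (enum_val q) == enum_val q'))%:R))
   (\matrix_(q < N, v < n) - (~~ goes (enum_val q)
      && (stop (enum_val q).1 == widen_ord (leqnSn n) v))%:R)
   (vertex_token_mx b phi) A.
Proof.
congr col_mx; apply/matrixP => q u; rewrite mxE.
by case: (split_ordP u) => u' ->; rewrite ?row_mxEl ?row_mxEr !mxE.
Qed.

(* The rows of the tokens of colour c add up to 0. *)
Lemma det_set_mx_full S b A phi c : S c = setT -> \det (set_mx S b A phi) = 0.
Proof.
move=> Sc; apply/eqP/det0P; rewrite set_mx_block.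
exists (row_mx (\row_(q < N) ((enum_val q).2 == c)%:R) 0).
  apply/eqP => /rowP/(_ (lshift n (enum_rank (ord0, c))))/eqP.
  by rewrite row_mxEl !mxE enum_rankK eqxx oner_eq0.
rewrite mul_row_block !mul0mx !addr0 -[RHS]row_mx0; congr row_mx; last first.
  apply/rowP => v; rewrite !mxE big1 // => q _; rewrite !mxE.
  by case: eqP => [->|_]; rewrite ?mul0r // Sc inE oppr0 mulr0.
apply/rowP => q'; rewrite !mxE; under eq_bigr => q _.
  rewrite !mxE -(inj_eq enum_val_inj) mulrBr.
  over.
rewrite sumrB /=.
rewrite (sum_enum_val (fun x : token => (x.2 == c)%:R * (x == enum_val q')%:R)).
rewrite (sum_enum_val (fun x : token => (x.2 == c)%:R
  * ((x.1 \in S x.2) && (next_token x == enum_val q'))%:R)).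
rewrite (bigD1 (enum_val q')) //= eqxx mulr1 big1 ?addr0; last first.
  by move=> x /negPf ->; rewrite mulr0.
set y := enum_val q'; pose y0 : token := (ord_pred y.1, y.2).
have e : next_token y0 = y by rewrite /next_token ord_predK -surjective_pairing.
rewrite (bigD1 y0) //= e eqxx big1 ?addr0 => [|x /negPf ne]; last first.
  by rewrite -e (inj_eq next_token_inj) ne andbF mulr0.
by case: eqP => [->|_]; rewrite ?Sc ?inE ?mulr1 ?mul0r ?subrr.
Qed.

(** Column operations replace each token by the vertex at which it stops. The token block that
    remains has determinant 1, because every token eventually stops. *)
Lemma det_set_mx_proper S b A phi : (forall c, S c != setT) ->
  \det (set_mx S b A phi)
  = \det (\matrix_(i, v) (A i v + \sum_j b i j *
      (stop (alpha (ord_pred j) (S (phi i))) == widen_ord (leqnSn n) v)%:R)).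
Proof.
move=> SnT; rewrite set_mx_block /=; set P := matrix_of_fun _ _.
pose z (x : token) v : R :=
  (stop (alpha (ord_pred x.1) (S x.2)) == widen_ord (leqnSn n) v)%:R.
pose Z : 'M_(N, n) := \matrix_(q, v) z (enum_val q) v.
have det_id : \det (block_mx 1%:M Z 0 1%:M) = 1 by rewrite det_ublock !det1 mulr1.
rewrite -[LHS]mulr1 -[X in _ * X = _]det_id -det_mulmx mulmx_block.
rewrite !mulmx1 !mulmx0 !addr0.
rewrite [P *m Z + _](_ : _ = 0); last first.
  apply/matrixP => q v; rewrite !mxE; set x := enum_val q.
  under eq_bigr => q' _.
    rewrite !mxE -(inj_eq enum_val_inj) mulrBl -mulnb natrM -mulrA.
    over.
  rewrite sumrB -mulr_sumr.
  rewrite !(sum_enum_val (fun y : token => (_ == y)%:R * z y v)) !sum_delta.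
  rewrite /z /= ordSK alpha_rec // ord_predK -/x.
  by case: (_ \in _); rewrite ?mul1r ?mul0r ?subr0 ?oppr0 ?addr0 subrr.
rewrite det_lblock -[RHS]mul1r; congr (_ * _); last first.
  congr (\det _); apply/matrixP => i v.
  by rewrite addrC mxE vertex_token_mxM !mxE.
have out c : exists j, j \notin S c.
  apply/existsP; rewrite -negb_forall; apply: contra (SnT c) => /forallP h.
  by apply/eqP/setP => x; rewrite h inE.
(* Each move brings a token closer to a fixed non-element of its set; a stopped token is [None], of
   rank 0. *)
pose dist (o : option token) := if o is Some x then
  (xchoose (out x.2) - x.1 : 'I_n.+1)%R.+1 else 0%N.
pose w (q : 'I_N) := Some (enum_val q).
pose h (q : 'I_N) := let x := enum_val q in
  if x.1 \in S x.2 then Some (next_token x) else None.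
transitivity (\det (arc_mx R w h)).
  by congr (\det _); apply/matrixP => q q'; rewrite !mxE /h; case: (_ \in _).
apply: (@det_arc_mx1 _ _ _ _ _ dist) => q; rewrite /h; case: ifP => // goes.
have ne : xchoose (out (enum_val q).2) != (enum_val q).1.
  by apply: contraTneq goes => <-; apply: (xchooseP (out _)).
by rewrite /w /dist val_subI_ordS // prednK ?val_subI_gt0.
Qed.

End Evaluation.

End TokenMatrix.

(** * Independence of the colouring, by generating functions *)

Section ColourIndependence.
Variables (n r : nat) (stop : 'I_n.+1 -> 'I_n.+1).
Variables (b : 'M[int]_(n, n.+1)) (A : 'M[int]_n).

Local Notation token := ('I_n.+1 * 'I_r)%type.
Local Notation N := #|{: token}|.
Local Notation MP := {mpoly int[n.+1]}.
Local Notation toMP := (map_mx (@mpolyC n.+1 int)).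

Definition weighted_mx (phi : 'I_n -> 'I_r) : 'M[MP]_(N + n) :=
  col_mx (\matrix_(q < N, u < N + n) \sum_(goes : bool)
            (if goes then 'X_(enum_val q).1 else 1)
            * toMP (token_row r stop int goes) q u)
         (toMP (row_mx (vertex_token_mx b phi) A)).

Definition multiplicities (S : 'I_r -> {set 'I_n.+1}) : 'X_{1..n.+1} :=
  [multinom #|[set c | j \in S c]| | j < n.+1].

(** Choosing a value for each token row amounts to choosing S; the chosen weights contribute a
    factor t_j for each c with j in S_c. *)
Lemma det_weighted_mx phi : \det (weighted_mx phi) =
  \sum_(S : {ffun 'I_r -> {set 'I_n.+1}})
    'X_[multiplicities S] * (\det (set_mx stop S b A phi))%:MP.
Proof.
rewrite /weighted_mx (det_sum_rows
  (fun (goes : bool) (q : 'I_N) => if goes then 'X_(enum_val q).1 else 1 : MP)).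
pose toS (f : {ffun 'I_N -> bool}) : {ffun 'I_r -> {set 'I_n.+1}} :=
  [ffun c => [set j | f (enum_rank (j, c))]].
pose ofS (S : {ffun 'I_r -> {set 'I_n.+1}}) : {ffun 'I_N -> bool} :=
  [ffun q => (enum_val q).1 \in S (enum_val q).2].
have ofSK : cancel ofS toS.
  by move=> S; apply/ffunP => c; apply/setP => j; rewrite ffunE inE ffunE enum_rankK.
have toSK : cancel toS ofS.
  move=> f; apply/ffunP => q; rewrite !ffunE inE.
  by rewrite -surjective_pairing enum_valK.
rewrite (reindex ofS); last by apply: onW_bij; exists toS.
apply: eq_bigr => S _; congr (_ * _).
  rewrite mpolyXE_id; under eq_bigr => q _ do rewrite ffunE.
  pose F j c : MP := if j \in S c then 'X_j else 1.
  transitivity (\prod_x F x.1 x.2); last first.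
    rewrite -(pair_bigA _ F); apply: eq_bigr => j _ /=.
    rewrite mnmE -prodr_const [RHS]big_mkcond.
    by apply: eq_bigr => c _; rewrite inE.
  by rewrite [RHS](reindex _ (onW_bij _ (enum_val_bij _))).
rewrite -det_map_mx map_col_mx; congr (\det (col_mx _ _)).
by apply/matrixP => q u; rewrite !mxE ffunE.
Qed.

Lemma det_weighted_mx_colour_blind phi phi' :
  \det (weighted_mx phi) = \det (weighted_mx phi').
Proof.
have natE (x : bool) : (x%:R)%:MP = x%:R :> MP by rewrite mpolyC_nat.
have weighted_block f : weighted_mx f = block_mx
    (\matrix_(q < N, q' < N) ((1 + 'X_(enum_val q).1) * (q == q')%:R
      - 'X_(enum_val q).1 * (next_token (enum_val q) == enum_val q')%:R))
    (\matrix_(q < N, v < n) - (stop (enum_val q).1 == widen_ord (leqnSn n) v)%:R)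
    (vertex_token_mx (toMP b) f) (toMP A).
  congr col_mx; last first.
    rewrite map_row_mx; congr row_mx; apply/matrixP => i q; rewrite !mxE.
    by rewrite mpolyCM natE.
  have toE (B : 'M[int]_(N, N + n)) q u : toMP B q u = (B q u)%:MP by rewrite mxE.
  apply/matrixP => q u; rewrite mxE big_bool /= !toE.
  case: (split_ordP u) => v ->; rewrite ?(row_mxEl, row_mxEr) !mxE /=.
    by rewrite !mpolyCB !natE; ring.
  by rewrite !mpolyCN !natE; ring.
rewrite !weighted_block; apply: (@det_block_colour_blind _ _ _ _ (fun j => 'X_j)).
(* At t = 0 the matrix is the identity, so its determinant is a nonzero polynomial. *)
apply/eqP => /(congr1 (meval (fun=> 0 : int))); rewrite meval0 -det_map_mx.
rewrite (_ : map_mx _ _ = 1%:M) ?det1; first exact/eqP/oner_neq0.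
apply/matrixP => j j'; rewrite !mxE rmorphB !rmorphM rmorphD rmorph1 !rmorph_nat /=.
by rewrite !mevalXU; ring.
Qed.

(** Each side is the coefficient of t^p in a weighted determinant, and these determinants agree. *)
Lemma sum_det_set_mx p (phi phi' : 'I_n -> 'I_r) : (forall j, 0 <= p j) ->
  \sum_(S in calS p r) \det (set_mx stop S b A phi)
  = \sum_(S in calS p r) \det (set_mx stop S b A phi').
Proof.
move=> p_ge0; pose m := [multinom `|p j|%N | j < n.+1].
suff sumE f : \sum_(S in calS p r) \det (set_mx stop S b A f)
    = (\det (weighted_mx f))@_m.
  by rewrite !sumE (det_weighted_mx_colour_blind phi phi').
rewrite det_weighted_mx raddf_sum big_mkcond; apply: eq_bigr => S _ /=.
rewrite mulrC mcoeffCM mcoeffX.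
suff -> : (multiplicities S == m) = (S \in calS p r).
  by case: ifP; rewrite ?mulr1 ?mulr0.
rewrite inE; apply/eqP/forallP => [/mnmP mE j|mE].
  by have := mE j; rewrite !mnmE => ->; rewrite gez0_abs.
by apply/mnmP => j; rewrite !mnmE; have /eqP <- := mE j.
Qed.

End ColourIndependence.

(** * Trees *)

Lemma uniq_map_inj_in (T U : eqType) (f : T -> U) (s : seq T) :
  uniq (map f s) -> {in s &, injective f}.
Proof.
move=> + x y xs ys fxy; move/(uniqP (f x))/(_ (index x s) (index y s)).
rewrite !inE size_map !index_mem !(nth_map x) ?index_mem // !nth_index //.
by move=> /(_ xs ys fxy) e; rewrite -(nth_index x xs) e nth_index.
Qed.

Section RootedTrees.
Variables (n : nat) (h : 'I_n -> 'I_n.+1).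

Local Notation widen := (widen_ord (leqnSn n)).

(** The arc map, extended by a loop at the root: [insub] fails only at vertex k. *)
Definition step (x : 'I_n.+1) : 'I_n.+1 := oapp h x (insub (x : nat)).

Definition reaches_root : bool := [forall x, fconnect step x ord_max].

Local Notation arc := (fun i => (widen i, h i)).

Lemma widen_neq_max i : widen i != ord_max.
Proof. by rewrite -val_eqE /= neq_ltn ltn_ord. Qed.

Lemma neq_maxP x : reflect (exists i, x = widen i) (x != ord_max).
Proof.
apply: (iffP idP) => [x_max|[i ->]]; last exact: widen_neq_max.
have xn : (x < n)%N by rewrite ltn_neqAle -ltnS ltn_ord andbT -val_eqE in x_max *.
by exists (Ordinal xn); apply: val_inj.
Qed.

Lemma widen_inj : injective widen.
Proof. by move=> i j /(congr1 val) /= /val_inj. Qed.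

Lemma step_widen i : step (widen i) = h i.
Proof. by rewrite /step /= valK. Qed.

Lemma step_max : step ord_max = ord_max.
Proof. by rewrite /step insubF //= ltnn. Qed.

Lemma fconnect_widen i :
  fconnect step (widen i) ord_max = fconnect step (h i) ord_max.
Proof.
rewrite -step_widen; apply/idP/idP => [c|]; last exact/connect_trans/fconnect1.
have := fconnect_findex c; rewrite eq_sym widen_neq_max => /(_ isT) e.
have := iter_findex c; rewrite e iterSr => <-; exact: fconnect_iter.
Qed.

(** If every vertex reaches the root, the distance to it decreases along arcs; otherwise the
    vertices that do not reach it form a set closed under arcs in both directions. *)
Lemma det_arc_reaches (R : idomainType) :
  \det (arc_mx R widen h) = (reaches_root)%:R.
Proof.
case: (boolP reaches_root) => [/forallP reach|].
  apply: (@det_arc_mx1 _ _ _ _ _ (fun x => findex step x ord_max)) => i.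
  by rewrite (fconnect_findex (reach (widen i))) ?step_widen // eq_sym widen_neq_max.
rewrite negb_forall => /existsP[x nreach].
have x_max : x != ord_max by apply: contraNneq nreach => ->; exact: connect0.
have [i xE] := neq_maxP _ x_max.
apply: (@det_arc_mx0 _ _ _ _ _ [pred x | ~~ fconnect step x ord_max] i) => /=.
- exact: widen_inj.
- by move=> j; rewrite fconnect_widen.
- by move=> y ny; apply/neq_maxP; apply: contraNneq ny => ->; exact: connect0.
- by rewrite -xE.
Qed.

(** A walk that misses the root is eventually periodic, which yields a cycle. Conversely, walks to
    the root connect the graph, and the distance to the root excludes cycles. *)
Lemma is_tree_reaches : is_tree arc = reaches_root.
Proof.
apply/andP/forallP => [[_ acyc] x|reach].
  apply: contraT => nreach.
  have nmax k : iter k step x != ord_max.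
    by apply: contraNneq nreach => <-; exact: fconnect_iter.
  have [i0 _] := neq_maxP _ (nmax 0%N).
  have /trajectP[k k_lt kE] := looping_order step x.
  pose y := iter k step x; pose idx (z : 'I_n.+1) := odflt i0 (insub (z : nat)).
  have idxK z : fconnect step y z -> widen (idx z) = z /\ h (idx z) = step z.
    move=> yz; have xz : fconnect step x z.
      exact: connect_trans (fconnect_iter _ k x) yz.
    have : z != ord_max by rewrite -(iter_findex xz).
    by case/neq_maxP => i ->; rewrite step_widen /idx /= valK.
  have /(orbitPcycle 3 0) y_cycle : exists m, iter m.+1 step y = y.
    exists (order step x - k).-1; rewrite prednK ?subn_gt0 //.
    by rewrite -iterD subnK // ltnW.
  have size_lt : (size [seq (z, idx z) | z <- orbit step y] < #|'I_n.+1|.+1)%N.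
    by rewrite size_map size_orbit ltnS max_card.
  have /forallP/(_ (Ordinal size_lt)) /forallP/(_ (in_tuple _))/negP[] := acyc.
  rewrite /is_cycle /= /unzip1 /unzip2 -!map_comp map_id orbit_uniq /=.
  apply/and3P; split.
  - by rewrite /orbit -orderSpred.
  - rewrite map_inj_in_uniq ?orbit_uniq // => z z' /= + + /(congr1 widen).
    by rewrite -!fconnect_orbit => /idxK[-> _] /idxK[-> _].
  rewrite cycle_map; move: y_cycle.
  apply: (@sub_in_cycle _ (mem (orbit step y))) => [z z' /= zy _ /eqP <-|].
    rewrite /joins /=; move: zy; rewrite -fconnect_orbit => /idxK[-> ->].
    by rewrite eqxx.
  by apply/allP.
pose d x := findex step x ord_max.
have d_lt i : (d (h i) < d (widen i))%N.
  by rewrite {2}/d (fconnect_findex (reach _)) ?step_widen // eq_sym widen_neq_max.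
split.
  have sym : connect_sym [rel u v | [exists e, joins arc e u v]].
    by apply: sym_connect_sym => u v; apply: eq_existsb => e; rewrite /joins orbC.
  suff to_max x : connect [rel u v | [exists e, joins arc e u v]] x ord_max.
    apply/forallP => x; apply/forallP => y.
    by apply: connect_trans (to_max x) _; rewrite sym.
  apply: connect_sub (reach x) => u v /= /eqP <-.
  case: (eqVneq u ord_max) => [->|/neq_maxP[i ->]]; first by rewrite step_max.
  by rewrite step_widen; apply/connect1/existsP; exists i; rewrite /joins eqxx.
apply/forallP => m; apply/forallP => c; apply/negP => /and4P[c_neq0 _ uniq_e cyc].
have [u0 u0c] : exists u0, u0 \in tval c.
  by case: (tval c) c_neq0 => // u0 s _; exists u0; exact: mem_head.
have [u uc umax] := arg_maxnP (fun u => d u.1) u0c.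
(* At a vertex of maximal rank both edges of the cycle are its outgoing arc. *)
have tail e x y : joins arc e x y -> (d y <= d x)%N -> widen e = x /\ h e = y.
  case/orP => /eqP[<- <-] //; by rewrite leqNgt d_lt.
have pc : prev c u \in tval c by rewrite mem_prev.
have nc : next c u \in tval c by rewrite mem_next.
have [ue _] := tail _ _ _ (next_cycle cyc uc) (umax _ nc).
have := prev_cycle cyc uc; rewrite /= /joins orbC => /tail /(_ (umax _ pc))[pe ph].
have eq_u : prev c u = u.
  by apply: (uniq_map_inj_in uniq_e) => //; apply: widen_inj; rewrite ue.
by have := d_lt (prev c u).2; rewrite pe ph eq_u ltnn.
Qed.

End RootedTrees.

(** * Trees in the case of a single set *)

Section Walks.
Variable n : nat.
Implicit Types (i : 'I_n) (x : 'I_n.+1) (S : {set 'I_n.+1}).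

Local Notation widen := (widen_ord (leqnSn n)).

Lemma ord_pred0 : ord_pred ord0 = ord_max :> 'I_n.+1.
Proof. by apply/val_inj; rewrite /= modn_small. Qed.

Lemma ord_predE x : x != ord0 -> ord_pred x = x.-1 :> nat.
Proof. by rewrite val_ord_pred => /negPf ->. Qed.

Lemma reaches_by_rank (h : 'I_n -> 'I_n.+1) (d : 'I_n.+1 -> nat) :
  (forall i, (d (h i) < d (widen i))%N) -> reaches_root h.
Proof.
move=> dlt; apply/forallP => x; have [m] := ubnP (d x).
elim: m x => // m IHm x; case: (eqVneq x ord_max) => [-> *|]; first exact: connect0.
case/neq_maxP => i -> xm; rewrite fconnect_widen; apply: IHm.
exact: leq_trans (dlt i) _.
Qed.

Lemma not_reaches_closed (h : 'I_n -> 'I_n.+1) (C : pred 'I_n.+1) i :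
  ~~ C ord_max -> C (widen i) -> (forall j, C (widen j) -> C (h j)) ->
  ~~ reaches_root h.
Proof.
move=> Cmax Ci Ch; apply: contra Cmax => /forallP/(_ (widen i))/iter_findex <-.
elim: (findex _ _ _) => //= m; set x := iter _ _ _.
case: (eqVneq x ord_max) => [->|/neq_maxP[j ->] /Ch]; first by rewrite step_max.
by rewrite step_widen.
Qed.

(** The walk from x stops at the non-element j at the latest, so it cannot jump over j. *)
Lemma alpha_decreases_dist S x j : S != setT -> j \notin S -> x != j ->
  ((j - alpha x S)%R < (j - x)%R)%N.
Proof.
move=> SnT; have [m] := ubnP (j - x)%R; elim: m x => // m IHm x xm jS xj.
have jx : j != x by rewrite eq_sym.
have xj_gt0 := val_subI_gt0 j x; rewrite jx in xj_gt0.
have dS := val_subI_ordS jx; rewrite alpha_rec //; case: ifPn => [xS|_].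
  have ne : ordS x != j by apply: contraNneq jS => <-.
  by apply: (@ltn_trans (j - ordS x)%R); [apply: IHm => //|]; lia.
by rewrite dS; lia.
Qed.

Lemma reaches_alpha S : (0 < n)%N -> S != setT ->
  reaches_root (fun i => alpha (widen i) S) = (ord_max \notin S).
Proof.
move=> n_gt0 SnT; case: (boolP (ord_max \in S)) => maxS.
  (* Every head lies outside S, hence differs from k; vertex 1 is added to supply a starting
     point. *)
  apply/negbTE/(@not_reaches_closed _ (predU [pred x | x \notin S]
     [pred x | x == widen (Ordinal n_gt0)]) (Ordinal n_gt0)) => /=.
  - by rewrite negb_or negbK maxS eq_sym widen_neq_max.
  - by rewrite eqxx orbT.
  - by move=> j _; rewrite (alphaP _ SnT).1.
apply: (reaches_by_rank (d := fun x => (ord_max - x)%R : nat)) => i.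
exact: alpha_decreases_dist (widen_neq_max i).
Qed.

Lemma reaches_beta S : (0 < n)%N -> S != setT ->
  reaches_root (fun i => beta (widen i) S) = (S == [set~ ord0]).
Proof.
move=> n_gt0 SnT; have [SE|SN] := eqVneq S [set~ ord0].
  apply: (reaches_by_rank (d := fun x => (x != ord_max) : nat)) => i.
  rewrite widen_neq_max beta_alpha //.
  have := (alphaP (widen i) SnT).1; rewrite {2}SE !inE negbK => /eqP ->.
  by rewrite ord_pred0 eqxx.
have [j jS j0] : exists2 j, j \notin S & j != ord0.
  apply/exists_inP; apply: contraR SN; rewrite negb_exists_in => /forall_inP h.
  have sub j : j != ord0 -> j \in S.
    by apply: contraLR => /h.
  rewrite eqEsubset; apply/andP; split; apply/subsetP => x; rewrite !inE;
    last exact: sub.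
  move=> xS; apply: contraNneq SnT => x0; apply/eqP/setP => y; rewrite inE.
  by case: (eqVneq y ord0) => [->|/sub //]; rewrite -x0.
(* The arc at j - 1 is a loop, and j - 1 is not the root since j is not vertex 1. *)
have /neq_maxP[i iE] : ord_pred j != ord_max.
  by apply: contraNneq j0 => /(congr1 (@ordS _)); rewrite ord_predK => ->;
    rewrite -ord_pred0 ord_predK.
apply/negbTE/(@not_reaches_closed _ (pred1 (widen i)) i) => /=.
- by rewrite eq_sym widen_neq_max.
- exact: eqxx.
move=> k /eqP ->; rewrite beta_alpha // -iE alpha_rec // ord_predK (negPf jS).
by rewrite iE -iE.
Qed.

Lemma reaches_gamma S : S != setT ->
  reaches_root (fun i => gamma (widen i) S) = (#|S| == n).
Proof.
move=> SnT; have cS := cardsC S; rewrite card_ord in cS.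
have -> : (#|S| == n) = (#|~: S| == 1)%N by apply/eqP/eqP; lia.
case: (boolP (#|~: S| == 1)%N) => [/cards1P[j SE]|SN].
  (* When j is the only non-element, every arc goes one step back, even at j, where the walk goes
     all the way round. *)
  have gE i : gamma (widen i) S = ord_pred (widen i).
    rewrite gamma_beta // beta_alpha //; case: ifPn => // iS.
    have : alpha (widen i) S \in ~: S by rewrite inE (alphaP _ SnT).1.
    have : widen i \in ~: S by rewrite inE.
    by rewrite SE !inE => /eqP -> /eqP ->.
  apply: (reaches_by_rank (d := fun x => if x == ord_max then 0%N else x.+1)) => i.
  rewrite gE (negPf (widen_neq_max i)); case: ifP => // ne.
  have i0 : widen i != ord0 by apply: contraFneq ne => ->; rewrite ord_pred0 eqxx.
  by rewrite (ord_predE i0) ltnS prednK // lt0n.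
have [a [b [aS bS ab]]] : exists a b, [/\ a \notin S, b \notin S & (a < b)%N].
  have : (1 < #|~: S|)%N.
    by move/eqP: SN; have := proper_card (_ : S \proper setT); rewrite properT SnT
      cardsT card_ord; lia.
  case/card_gt1P => a [b [aS bS]]; rewrite !inE in aS bS.
  rewrite neq_ltn => /orP[ab|ba]; [by exists a, b|by exists b, a].
have [i aE] : exists i, a = widen i.
  by apply/neq_maxP; rewrite -val_eqE /=; have := ltn_ord b; lia.
(* Between the non-elements a < b, backward steps stop at a and forward
   walks stop before b. *)
apply/negbTE/(@not_reaches_closed _ [pred x : 'I_n.+1 | a <= x < b]%N i).
- by rewrite /=; have := ltn_ord b; lia.
- by rewrite {1}aE /= leqnn (leq_ltn_trans _ ab) ?aE.
move=> j /andP[/= aj jb]; suff: (a <= gamma (widen j) S < b)%N by [].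
rewrite gamma_beta // beta_alpha //; case: ifPn => jS.
  have ja : j != a :> nat.
    by apply: contraNneq aS => e; rewrite (_ : a = widen j) //; exact: val_inj.
  have j0 : widen j != ord0 by rewrite -val_eqE /=; lia.
  by rewrite (ord_predE j0) /=; lia.
have jb' : widen j != b by rewrite -val_eqE /=; lia.
set x := alpha _ _; have xn := ltn_ord x.
have /andP[jx xb] : (j < x <= b)%N.
  have := alpha_decreases_dist SnT bS jb'.
  rewrite -/x !val_subI (ltnW jb : widen j <= b)%N.
  by case: ifP => /=; lia.
have x0 : x != ord0 by rewrite -val_eqE /=; lia.
by rewrite (ord_predE x0); lia.
Qed.

End Walks.

(** * Probabilities *)

Lemma surjections_neq0 (n r : nat) :
  (0 < r <= n)%N -> surjections 'I_n 'I_r != set0.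
Proof.
case: r => // r r_lt_n; apply/set0Pn.
exists [ffun i : 'I_n => inord i]; rewrite inE; apply/forallP => y.
have yn : (y < n)%N by have := ltn_ord y; lia.
by apply/existsP; exists (Ordinal yn); rewrite ffunE inord_val.
Qed.

Lemma sum_indicator (R : pzRingType) (T : finType) (X : {set T}) (P : pred T) :
  \sum_(x in X) (P x)%:R = #|[set x in X | P x]|%:R :> R.
Proof.
rewrite -sum1_card natr_sum big_mkcond [RHS]big_mkcond; apply: eq_bigr => x _.
by rewrite inE; case: (x \in X); case: (P x).
Qed.

Lemma Pr_unif (T : finType) (X : {set T}) (P : pred T) :
  Pr (unif X) P = #|[set x in X | P x]|%:R / #|X|%:R.
Proof.
rewrite /Pr /unif -mulr_suml -sum_indicator; congr (_ / _).
rewrite big_mkcond [RHS]big_mkcond; apply: eq_bigr => x _.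
by case: (x \in X); case: (P x).
Qed.

(** * Reduction to a constant colouring *)

Section RandomTrees.
Variables (n r : nat) (p : 'I_n.+1 -> int).
Hypothesis p_ge0 : forall j, 0 <= p j.
Implicit Types (zeta : 'I_n.+1 -> {set 'I_n.+1} -> 'I_n.+1).

Local Notation widen := (widen_ord (leqnSn n)).

Definition walk zeta (S : 'I_r -> {set 'I_n.+1}) (phi : 'I_n -> 'I_r) i :=
  zeta (widen i) (S (phi i)).

Definition colour_blind zeta := forall phi phi' : 'I_n -> 'I_r,
  \sum_(S in calM p r) (reaches_root (walk zeta S phi))%:R
  = \sum_(S in calM p r) (reaches_root (walk zeta S phi'))%:R :> int.

(** It suffices to write the arc relation of i as a combination of vertices ([A]) and tokens ([b]).
    Tuples with a full set have determinant 0, so the sum over [calM] extends to [calS]. *)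
Lemma colour_blind_of_relations zeta (stop : 'I_n.+1 -> 'I_n.+1)
    (b : 'M[int]_(n, n.+1)) (A : 'M[int]_n) :
  (forall (S : {set 'I_n.+1}) i v, S != setT ->
     A i v + \sum_j b i j * (stop (alpha (ord_pred j) S) == widen v)%:R
     = (i == v)%:R - (zeta (widen i) S == widen v)%:R) ->
  colour_blind zeta.
Proof.
move=> rel phi phi'; suff sumE f :
    \sum_(S in calM p r) (reaches_root (walk zeta S f))%:R
    = \sum_(S in calS p r) \det (set_mx stop S b A f).
  by rewrite !sumE; apply: sum_det_set_mx.
rewrite [RHS](bigID (fun S : {ffun 'I_r -> {set 'I_n.+1}} =>
  [forall i, S i != setT])) /= [X in _ = _ + X]big1 ?addr0; last first.
  move=> S /andP[_]; rewrite negb_forall => /existsP[c]; rewrite negbK => /eqP.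
  exact: det_set_mx_full.
apply: eq_big => [S|S]; first by rewrite inE.
rewrite inE => /andP[_ /forallP SnT]; rewrite det_set_mx_proper //.
rewrite -(det_arc_reaches _ int); congr (\det _); apply/matrixP => i v.
by rewrite !mxE rel ?SnT.
Qed.

Lemma sum_opp_delta (j0 : 'I_n.+1) (F : 'I_n.+1 -> int) :
  \sum_j - (j0 == j)%:R * F j = - F j0.
Proof. by under eq_bigr do rewrite mulNr; rewrite sumrN sum_delta. Qed.

(** The arc relation is e_i - x_(i+1,c), tokens stopping at the first non-element; for [beta] they
    stop one position earlier. *)
Lemma colour_blind_alpha : colour_blind (@alpha n).
Proof.
apply: (@colour_blind_of_relations _ id (\matrix_(i, j) - (ordS (widen i) == j)%:R)
  (\matrix_(i, v) (i == v)%:R)) => S i v SnT; rewrite mxE.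
under eq_bigr => j _ do rewrite mxE.
by rewrite sum_opp_delta ordSK.
Qed.

Lemma colour_blind_beta : colour_blind (@beta n).
Proof.
apply: (@colour_blind_of_relations _ (@ord_pred _)
  (\matrix_(i, j) - (ordS (widen i) == j)%:R)
  (\matrix_(i, v) (i == v)%:R)) => S i v SnT; rewrite mxE.
under eq_bigr => j _ do rewrite mxE.
by rewrite sum_opp_delta ordSK beta_alpha.
Qed.

(* The arc relation of i is stated as the difference
   (e_i - x_(i+1,c)) - (e_(i-1) - x_(i,c)) of two relations of beta. *)
Lemma colour_blind_gamma : colour_blind (@gamma n).
Proof.
apply: (@colour_blind_of_relations _ (@ord_pred _)
  (\matrix_(i, j) ((widen i == j)%:R - (ordS (widen i) == j)%:R))
  (\matrix_(i, v) ((i == v)%:R - (ord_pred (widen i) == widen v)%:R)))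
  => S i v SnT; rewrite mxE.
under eq_bigr => j _ do rewrite mxE mulrBl.
rewrite sumrB !sum_delta ordSK (alpha_rec (ord_pred _)) // ord_predK.
by rewrite gamma_beta // beta_alpha //; case: ifP => _; ring.
Qed.

(** For each fixed phi the number of trees is that of the constant colouring [c], where every arc
    uses S_c; averaging over phi changes nothing. *)
Lemma Ptree_good zeta (good : pred {set 'I_n.+1}) (c : 'I_r) :
  (r < n.+1)%N -> colour_blind zeta ->
  (forall S, S != setT -> reaches_root (fun i => zeta (widen i) S) = good S) ->
  Ptree zeta p r = Pr (unif (calM p r)) (fun S => good (S c)).
Proof.
move=> r_lt_k blind goodE.
have PrE (phi : {ffun 'I_n -> 'I_r}) :
    \sum_(S | is_tree (Gdigraph zeta S phi)) unif (calM p r) S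
    = Pr (unif (calM p r)) (fun S => good (S c)).
  rewrite [LHS]Pr_unif Pr_unif; congr (_ / _).
  apply/eqP; rewrite eqr_nat -(eqr_nat int) -!sum_indicator; apply/eqP.
  transitivity (\sum_(S in calM p r) (reaches_root (walk zeta S phi))%:R : int).
    by apply: eq_bigr => S _; rewrite is_tree_reaches.
  rewrite (blind phi (fun=> c)); apply: eq_bigr => S.
  by rewrite inE => /andP[_ /forallP SnT]; rewrite -(goodE _ (SnT c)).
rewrite /Ptree /Pr (eq_bigl (fun x => true && is_tree (Gdigraph zeta x.1 x.2))) //.
rewrite big_mkcond /=.
pose F S f := if is_tree (Gdigraph zeta S f) then
  unif (calM p r) S * unif (surjections 'I_n 'I_r) f else 0.
rewrite (eq_bigr (fun x => F x.1 x.2)) // -(pair_bigA _ F) exchange_big /=.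
transitivity (\sum_f Pr (unif (calM p r)) (fun S => good (S c))
   * unif (surjections 'I_n 'I_r) f).
  apply: eq_bigr => f _; rewrite -(PrE f) mulr_suml [RHS]big_mkcond.
  by apply: eq_bigr.
rewrite -mulr_sumr (_ : \sum_f _ = 1) ?mulr1 //.
transitivity (Pr (unif (surjections 'I_n 'I_r)) predT); first by [].
rewrite Pr_unif (_ : [set x in _ | _] = surjections 'I_n 'I_r).
  rewrite divff // pnatr_eq0 cards_eq0 surjections_neq0 //.
  by rewrite (leq_ltn_trans (leq0n c) (ltn_ord c)).
by apply/setP => f; rewrite inE andbT.
Qed.

End RandomTrees.

(** * Evaluation of the probabilities *)

Section Values.
Variables (n : nat).
Implicit Types p : 'I_n.+1 -> int.

Lemma sum_eq_setC1 (T : finType) (S : {set T}) :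
  (\sum_j (S == [set~ j]) = (#|S|.+1 == #|T|))%N.
Proof.
case: eqP => [cS|ncS]; last first.
  rewrite big1 // => j _; case: eqP => // SE; case: ncS.
  by rewrite SE -(cardsC [set j]) cards1.
have /cards1P[j SE] : #|~: S| == 1%N by have := cardsC S; rewrite -cS; lia.
rewrite (bigD1 j) //= big1 => [|j' /negPf ne].
  by rewrite -SE setCK eqxx.
rewrite -[S]setCK SE (inj_eq (can_inj (@setCK _))).
by rewrite (inj_eq set1_inj) eq_sym ne.
Qed.

(** Deleting the first set is a bijection with inverse [ins]: only j keeps its multiplicity, and the
    inserted set is not full since it misses j. *)
Lemma card_calM_fst p r (j : 'I_n.+1) :
  #|[set S in calM p r.+1 | S ord0 == [set~ j]]| = #|calM (dec_except p j) r|.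
Proof.
pose del (S : {ffun 'I_r.+1 -> {set 'I_n.+1}}) : {ffun 'I_r -> {set 'I_n.+1}} :=
  [ffun c => S (lift ord0 c)].
pose ins (S : {ffun 'I_r -> {set 'I_n.+1}}) : {ffun 'I_r.+1 -> {set 'I_n.+1}} :=
  [ffun c => oapp S [set~ j] (unlift ord0 c)].
have insK : cancel ins del.
  by move=> S; apply/ffunP => c; rewrite !ffunE liftK.
have delK (S : {ffun 'I_r.+1 -> {set 'I_n.+1}}) :
    S ord0 == [set~ j] -> ins (del S) = S.
  move=> /eqP S0; apply/ffunP => c; rewrite !ffunE.
  by case: unliftP => [c' ->|->] /=; rewrite ?ffunE ?S0.
rewrite -(card_imset _ (can_inj insK)); apply: eq_card => S.
have mult (S' : {ffun 'I_r -> {set 'I_n.+1}}) x :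
    #|[set c | x \in ins S' c]| = ((x != j) + #|[set c | x \in S' c]|)%N.
  rewrite -!sum1dep_card big_mkcond [in RHS]big_mkcond big_ord_recl.
  rewrite ffunE unlift_none /= !inE; congr (_ + _)%N.
  by apply: eq_bigr => c _; rewrite ffunE liftK.
have insM S' : (ins S' \in calM p r.+1) = (S' \in calM (dec_except p j) r).
  rewrite !inE; congr (_ && _).
    apply: eq_forallb => x; rewrite mult /dec_except.
    by case: (eqVneq x j) => _ /=; apply/eqP/eqP; lia.
  apply/forallP/forallP => [SnT c|SnT c].
    by have := SnT (lift ord0 c); rewrite ffunE liftK.
  rewrite ffunE; case: unliftP => [c' _|_] /=; first exact: SnT.
  by apply/eqP => /setP/(_ j); rewrite !inE eqxx.
apply/idP/imsetP => [|[S' S'M ->]].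
  rewrite inE => /andP[SM S0]; exists (del S); last by rewrite delK.
  by rewrite -insM delK.
by rewrite inE insM S'M ffunE unlift_none eqxx.
Qed.

Lemma card_calM_first p r (r_gt0 : (0 < r)%N) (j : 'I_n.+1) :
  #|[set S in calM p r | S (Ordinal r_gt0) == [set~ j]]|
  = #|calM (dec_except p j) r.-1|.
Proof.
case: r r_gt0 => // r r_gt0; rewrite -card_calM_fst.
by rewrite (_ : Ordinal r_gt0 = ord0) //; apply: val_inj.
Qed.

(** Summed over the colours, the common value gives r P, the mean number of sets avoiding k; that
    number is r - p_k for every tuple. *)
Lemma Pr_last_notin p r (P : rat) : (0 < r)%N -> calM p r != set0 ->
  (forall c : 'I_r, Pr (unif (calM p r)) (fun S => ord_max \notin S c) = P) ->
  P = 1 - (p ord_max)%:~R / r%:R.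
Proof.
move=> r_gt0 M_neq0 PE; have r_neq0 : r%:R != 0 :> rat by rewrite pnatr_eq0 -lt0n.
have M0 : #|calM p r|%:R != 0 :> rat by rewrite pnatr_eq0 cards_eq0.
apply: (mulIf r_neq0); rewrite mulrBl mul1r divfK //.
transitivity (\sum_(c < r) Pr (unif (calM p r)) (fun S => ord_max \notin S c)).
  by rewrite (eq_bigr _ (fun c _ => PE c)) sumr_const card_ord mulr_natr.
under eq_bigr => c _ do rewrite Pr_unif -sum_indicator.
rewrite -mulr_suml exchange_big /=; apply: (mulIf M0); rewrite divfK //.
rewrite [RHS]mulr_natr -sumr_const; apply: eq_bigr => S.
rewrite !inE => /andP[/forallP/(_ ord_max)/eqP <- _].
rewrite -[(_)%:~R]/(_%:R); have := cardsC [set c | ord_max \in S c].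
rewrite card_ord => /(congr1 (fun m => m%:R : rat)) <-.
rewrite natrD addrC addKr -natr_sum; congr _%:R.
rewrite -sum1_card [RHS]big_mkcond; apply: eq_bigr => c _.
by rewrite !inE; case: ifP.
Qed.

End Values.

Theorem theorem2p1 (n r : nat) (p : 'I_n.+1 -> int)
    (r_gt0 : (0 < r)%N) (r_lt_k : (r < n.+1)%N)
    (p_ge0 : forall j, 0 <= p j) (M_neq0 : calM p r != set0) :
  let S1 (S : {ffun 'I_r -> {set 'I_n.+1}}) := S (Ordinal r_gt0) in
  [/\ Ptree (@alpha n) p r = 1 - (p ord_max)%:~R / r%:R
      /\ Ptree (@alpha n) p r = Pr (unif (calM p r)) (fun S => ord_max \notin S1 S),
      Ptree (@beta n) p r
        = #|calM (dec_except p ord0) r.-1|%:R / #|calM p r|%:R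
      /\ Ptree (@beta n) p r
        = Pr (unif (calM p r)) (fun S => S1 S == [set~ ord0])
    & Ptree (@gamma n) p r
        = (\sum_(j < n.+1) #|calM (dec_except p j) r.-1|%:R) / #|calM p r|%:R
      /\ Ptree (@gamma n) p r
        = Pr (unif (calM p r)) (fun S => #|S1 S| == n)].
Proof.
have n_gt0 : (0 < n)%N by lia.
have alphaE c := Ptree_good c r_lt_k (colour_blind_alpha p_ge0)
  (fun S => @reaches_alpha n S n_gt0).
have betaE c := Ptree_good c r_lt_k (colour_blind_beta p_ge0)
  (fun S => @reaches_beta n S n_gt0).
have gammaE c := Ptree_good c r_lt_k (colour_blind_gamma p_ge0)
  (@reaches_gamma n).
move=> S1; split; split.
- by apply: Pr_last_notin => // c; rewrite (alphaE c).
- exact: alphaE.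
- by rewrite (betaE (Ordinal r_gt0)) Pr_unif card_calM_first.
- exact: betaE.
- rewrite (gammaE (Ordinal r_gt0)) Pr_unif -sum_indicator; congr (_ / _).
  (* The event |S_1| = k - 1 is split according to the missing element j. *)
  under [RHS]eq_bigr => j _ do rewrite -(card_calM_first p r_gt0) -sum_indicator.
  rewrite exchange_big; apply: eq_bigr => S _ /=.
  by rewrite -natr_sum sum_eq_setC1 card_ord eqSS.
- exact: gammaE.
Qed.
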